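(* Let $\mathcal B=\{b_1,\dots,b_m\}$, $\vec n=(n_1,\dots,n_m)\in\mathbb N^m$ and $L=\sum_i n_i$. Let $T_{\vec n}$ be the transition matrix of the Tsetlin library with multiple copies on words of content $\vec n$ with probabilities $x_{b,j}$. Then $$\det(\lambda\mathbb 1-T_{\vec n})=\prod_{I_1\subseteq[n_1],\dots,I_m\subseteq[n_m]}\Bigl(\lambda-\sum_{j=1}^m x_{b_j,I_j}\Bigr)^{d_{(n_1-|I_1|,\dots,n_m-|I_m|)}}.$$ When $x_{b,k}=x_b$ for all $b\in\mathcal B$ and all $k$, this simplifies to $$\det(\lambda\mathbb 1-T_{\vec n})=\prod_{(k_1,\dots,k_m)\le(n_1,\dots,n_m)}\Bigl(\lambda-\sum_{i=1}^m k_ix_{b_i}\Bigr)^{d_{(n_1-k_1,\dots,n_m-k_m)}\prod_{i=1}^m\binom{n_i}{k_i}},$$ where $\le$ is componentwise.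
   Context: States are the words $\pi=\pi_1\cdots\pi_L$ over $\mathcal B$ in which each $b_i$ occurs exactly $n_i$ times. For $b=b_i$ and $1\le j\le n_i$, the operator $\partial_{b,j}$ takes the $j$-th copy of $b$ (from the left) and moves it leftwards until it is immediately after the $(j-1)$-st copy of $b$ (if $j=1$, to the front of the word), keeping the relative order of all other letters. Nonnegative weights $x_{b,j}$ with $\sum_{b,j}x_{b,j}=1$ are given; the chain moves from $\pi$ to $\partial_{b,j}(\pi)$ with probability $x_{b,j}$, so $T_{\vec n}(\pi',\pi)=\sum_{(b,j):\,\partial_{b,j}(\pi)=\pi'}x_{b,j}$. For $I\subseteq[n_j]=\{1,\dots,n_j\}$, $x_{b_j,I}=\sum_{s\in I}x_{b_j,s}$. A word of content $\vec k=(k_1,\dots,k_m)$ is a derangement if no position of it holds the same letter as the corresponding position of $b_1^{k_1}b_2^{k_2}\cdots b_m^{k_m}$; $d_{\vec k}$ is the number of such derangements (with $d_{(0,\dots,0)}=1$, the empty word). *)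

(* Defs.v *)
From HB Require Import structures.
From mathcomp Require Import all_boot all_order all_algebra.

Set Implicit Arguments.
Unset Strict Implicit.
Unset Printing Implicit Defensive.

Import GRing.Theory.

Local Open Scope ring_scope.

(* The alphabet {b_1, ..., b_m} is 'I_m; contents are functions 'I_m -> nat.  *)
(* The copies of a letter are numbered from 0, so [n_j] becomes 'I_(n j).     *)

Definition has_content m (n : 'I_m -> nat) (s : seq 'I_m) : bool :=
  [forall i, count_mem i s == n i].

Definition word m (n : 'I_m -> nat) : Type :=
  {w : (\sum_i n i)%N.-tuple 'I_m | has_content n w}.

HB.instance Definition _ m (n : 'I_m -> nat) := Finite.on (word n).

Definition letters m (n : 'I_m -> nat) (w : word n) : seq 'I_m := tval (val w).

(* The first copy (j = 0) goes to the front. For j > 0 everything up to and   *)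
(* including the first copy of b stays put, and in the remaining suffix the   *)
(* (j - 1)-st copy is the one to be moved.                                    *)
Fixpoint promote (T : eqType) (b : T) (j : nat) (s : seq T) : seq T :=
  if j is j'.+1 then
    let p := (index b s).+1 in take p s ++ promote b j' (drop p s)
  else b :: rem b s.

Lemma perm_promote (T : eqType) (b : T) (j : nat) (s : seq T) :
  (j < count_mem b s)%N -> perm_eq (promote b j s) s.
Proof.
elim: j s => [|j IHj] s lt_j /=.
  by rewrite perm_sym perm_to_rem // -has_pred1 has_count.
rewrite -[X in perm_eq _ X](cat_take_drop (index b s).+1 s) perm_cat2l IHj //.
have bs : b \in s by rewrite -has_pred1 has_count (leq_trans _ lt_j).
have lt_b : (index b s < size s)%N by rewrite index_mem.
have take0 : count_mem b (take (index b s) s) = 0%N.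
  apply/eqP; rewrite -leqn0 leqNgt -has_count has_pred1.
  apply/negP => /[dup] b_take; rewrite in_take ?ltnn //.
rewrite -[s in (_ < count_mem b s)%N](cat_take_drop (index b s).+1) in lt_j.
by rewrite (take_nth b lt_b) nth_index // -cats1 !count_cat take0 /= eqxx in lt_j.
Qed.

Lemma promote_size m (n : 'I_m -> nat) (b : 'I_m) (j : 'I_(n b)) (w : word n) :
  size (promote b j (letters w)) == (\sum_i n i)%N.
Proof.
have /forallP/(_ b)/eqP cnt := valP w.
by rewrite (perm_size (perm_promote _)) ?size_tuple // cnt.
Qed.

Lemma promote_content m (n : 'I_m -> nat) (b : 'I_m) (j : 'I_(n b))
    (w : word n) : has_content n (Tuple (promote_size j w)).
Proof.
have /forallP cnt := valP w; apply/forallP => i /=.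
by rewrite (permP (perm_promote _)) ?cnt // (eqP (cnt b)).
Qed.

Definition partial m (n : 'I_m -> nat) (b : 'I_m) (j : 'I_(n b)) (w : word n) :
  word n := exist _ (Tuple (promote_size j w)) (promote_content j w).

(* Row index: the new state; column index: the old state. *)
Definition tsetlin_mx (R : pzRingType) m (n : 'I_m -> nat)
    (x : forall b : 'I_m, 'I_(n b) -> R) : 'M[R]_#|{: word n}| :=
  \matrix_(p, q) \sum_(b < m)
    \sum_(j < n b | partial j (enum_val q) == enum_val p) x b j.

Definition sorted_word m (k : 'I_m -> nat) : seq 'I_m :=
  flatten [seq nseq (k i) i | i <- enum 'I_m].

Definition derangement m (k : 'I_m -> nat) (w : word k) : bool :=
  all2 (fun a b => a != b) (letters w) (sorted_word k).

Definition num_derangements m (k : 'I_m -> nat) : nat :=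
  #|[set w : word k | derangement w]|.

(* Main.v *)
Require Import Defs.
From mathcomp Require Import all_boot all_order all_algebra.
From mathcomp Require Import perm ring.

(* In characteristic 0 a characteristic polynomial is determined by the traces
   of the powers of the matrix. The trace of [T ^+ k] is the sum, over products
   of [k] promotion operators, of their weight times their number of fixed
   words. Promoting copy [j] of [b] changes the relative order of copies of
   distinct letters only by letting copy [j] compare as copy [j - 1] did.
   Hence a word fixed by a product is determined by the subword of the copies
   that are not promoted in it, this subword can be arbitrary, and a product
   using the set [S] of copies has as many fixed words as there are words on
   the complement of [S]. Splitting off the positions where a word agrees with
   the sorted word, these are counted by the derangements on the sets [A]
   disjoint from [S]; interchanging the sums over [A] and over products turns
   the trace into the power sum of the claimed eigenvalues. *)

Set Implicit Arguments.
Unset Strict Implicit.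
Unset Printing Implicit Defensive.
Import GRing.Theory Num.Theory.

(** * Order comparisons between copies of distinct letters *)

Section Words.

Variable T : eqType.
Implicit Types (b c a : T) (s : seq T) (I : T -> pred nat).

(* The [j]-th copy of [b] stands to the left of the [l]-th copy of [c], for
   [b != c]; a missing copy counts as standing at the right end. *)
Fixpoint before s b j c l : bool :=
  if s is a :: s' then
    if a == b then (if j is j'.+1 then before s' b j' c l else true)
    else if a == c then (if l is l'.+1 then before s' b j c l' else false)
    else before s' b j c l
  else false.

(** One bound suffices: a missing copy of [c] counts as standing at the right end, hence behind the
    present copy [j] of [b]. Were both missing, both comparisons would be false. *)
Lemma before_sym s b j c l : b != c -> j < count_mem b s ->
  before s c l b j = ~~ before s b j c l.
Proof.
move=> bc; elim: s j l => //= a s IHs j l.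
have [->|ab] := eqVneq a b.
  by rewrite (negPf bc); case: j => //= j; rewrite add1n ltnS; apply: IHs.
by case: eqVneq => _; first case: l => // l; apply: IHs.
Qed.

Lemma promote0 b s : promote b 0 s = b :: rem b s.
Proof. by []. Qed.

Lemma promote_cons b j a s :
  promote b j.+1 (a :: s)
    = a :: promote b (if a == b then j else j.+1) s.
Proof. by rewrite /=; case: eqVneq => //= _; rewrite take0 drop0. Qed.

Lemma before_cons_same s b j c l :
  before (b :: s) b j c l = if j is j'.+1 then before s b j' c l else true.
Proof. by rewrite /= eqxx. Qed.

Lemma before_cons_other a s b j c l : a != b -> a != c ->
  before (a :: s) b j c l = before s b j c l.
Proof. by move=> ab ac; rewrite /= (negPf ab) (negPf ac). Qed.

Lemma before_rem b s j c l : b != c ->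
  before (rem b s) b j c l = before s b j.+1 c l.
Proof.
move=> bc; elim: s j l => //= a s IHs j l; have [//|ab] := eqVneq a b.
by rewrite /= (negPf ab); case: eqVneq => _; first case: l => // l; apply: IHs.
Qed.

(** Copy [j0] lands right behind copy [j0 - 1], or at the front if [j0] is 0, and inherits its
    comparisons. It overtakes no copy of [b], so the numbering is kept. *)
Lemma before_promote b j0 s j c l : b != c -> j0 < count_mem b s ->
  before (promote b j0 s) b j c l =
  if j == j0 then (if j is j'.+1 then before s b j' c l else true)
  else before s b j c l.
Proof.
move=> bc; elim: s j0 j l => // a s IHs [|j0] j l lt_j0.
  rewrite promote0 before_cons_same.
  by case: j => // j; rewrite before_rem.
rewrite promote_cons; move: lt_j0 => /=; have [ab|ab] := eqVneq a b.
  rewrite add1n ltnS => lt_j0; case: j => [//|j].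
  by rewrite IHs // eqSS; case: j {IHs} => //= j; rewrite eqxx.
rewrite add0n => lt_j0; have [ac|ac] := eqVneq a c.
  by case: l => [|l]; [case: eqP; case: j|rewrite IHs //; case: eqP => // _; case: j].
by rewrite IHs //; case: eqP => // _; case: j.
Qed.

Lemma before_promote_sym c l0 s b j l :
  b != c -> l0 < count_mem c s -> j < count_mem b s ->
  before (promote c l0 s) b j c l =
  if l == l0 then (if l is l'.+1 then before s b j c l' else false)
  else before s b j c l.
Proof.
move=> bc lt_l0 lt_j.
have sym t : count_mem b t = count_mem b s -> forall l,
    before t b j c l = ~~ before t c l b j.
  by move=> cb k; rewrite (@before_sym t b j) ?negbK ?cb.
rewrite sym; last by apply/seq.permP/perm_promote.
rewrite before_promote 1?eq_sym //.
by case: ifP => _; [case: l => //= l|]; rewrite sym.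
Qed.

Lemma before_promote_other a j0 s b j c l : a != b -> a != c ->
  j0 < count_mem a s -> before (promote a j0 s) b j c l = before s b j c l.
Proof.
move=> ab ac; have before_rem_other t i k : before (rem a t) b i c k = before t b i c k.
  elim: t i k => //= d t IHt i k; have [->|da] := eqVneq d a.
    by rewrite (negPf ab) (negPf ac).
  by rewrite /=; case: ifP => _; [case: i | case: ifP => _; [case: k|]].
elim: s j0 j l => // d s IHs [|j0] j l lt_j0.
  by rewrite promote0 before_cons_other.
rewrite promote_cons; move: lt_j0 => /=.
have [da|da] := eqVneq d a; rewrite ?add1n ?add0n => lt_j0.
  by rewrite da (negPf ab) (negPf ac) IHs.
by case: ifP => _; [case: j => // j | case: ifP => _; [case: l => // l|]]; rewrite IHs.
Qed.

Lemma before_inj s t :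
  (forall b, count_mem b s = count_mem b t) ->
  (forall b j c l, b != c -> j < count_mem b s -> l < count_mem c s ->
     before s b j c l = before t b j c l) ->
  s = t.
Proof.
elim: s t => [|a s IHs] [|d t] cnt eq_before //.
- by have := cnt d; rewrite /= eqxx.
- by have := cnt a; rewrite /= eqxx.
(* If the first letters differed, their copies 0 would compare in opposite ways in the two words. *)
have ad : a = d.
  apply/eqP/negPn/negP => ad; have := eq_before a 0 d 0 ad.
  have := cnt d; rewrite /= !eqxx (negPf ad) [d == a]eq_sym (negPf ad) => -> /=.
  by rewrite !add1n => /(_ isT isT).
case: d / ad cnt eq_before => cnt eq_before; congr (_ :: _).
apply: IHs => [b|b j c l bc jb lc].
  by have := cnt b => /= /addnI.
have := eq_before b ((a == b) + j) c ((a == c) + l) bc.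
rewrite /= !ltn_add2l => /(_ jb lc).
by have [->|_] := eqVneq a b; rewrite /= ?(negPf bc) //; case: eqP.
Qed.

(* Renumbers the marked copies after removal of a leading [a]. *)
Definition shift a I : T -> pred nat := fun b => if b == a then I b \o succn else I b.

(** * Subwords of the unmarked copies *)

Fixpoint del I s :=
  if s is a :: s' then
    if I a 0 then del (shift a I) s' else a :: del (shift a I) s'
  else [::].

(* The number under which copy [j] of [b] survives in [del I s]. *)
Definition rank I b j := \sum_(i < j) ~~ I b i.

Lemma rank_shift I a b j :
  rank I b ((a == b) + j) = ((a == b) && ~~ I b 0) + rank (shift a I) b j.
Proof.
rewrite /rank /shift eq_sym; case: eqP => [_|_]; last by rewrite !add0n.
by rewrite add1n big_ord_recl.
Qed.

Lemma count_del I s b : count_mem b (del I s) = rank I b (count_mem b s).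
Proof.
elim: s I => [|a s IHs] I /=; first by rewrite /rank big_ord0.
rewrite rank_shift -IHs.
by case: ifP => Ia /=; case: eqVneq => [<-|]; rewrite ?Ia.
Qed.

Lemma before_del I s b j c l : b != c -> ~~ I b j -> ~~ I c l ->
  before (del I s) b (rank I b j) c (rank I c l) = before s b j c l.
Proof.
move=> bc; elim: s I j l => //= a s IHs I j l Ib Ic.
have rankS d k : a = d -> rank I d k.+1 = ~~ I d 0 + rank (shift a I) d k.
  by move=> <-; have := rank_shift I a a k; rewrite eqxx.
have rank_other d k : a != d -> rank (shift a I) d k = rank I d k.
  by move=> ad; have := rank_shift I a d k; rewrite (negPf ad).
have shift_other d k : a != d -> shift a I d k = I d k.
  by rewrite /shift eq_sym => /negPf->.
have shift_same k : shift a I a k = I a k.+1 by rewrite /shift eqxx.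
have [ab|ab] := eqVneq a b.
  rewrite -{b}ab in bc IHs Ib *; rewrite -(rank_other c) //.
  case: j Ib => [|j] Ib; first by rewrite (negPf Ib) /= eqxx /rank big_ord0.
  by rewrite rankS //; case: ifP => _; rewrite /= ?eqxx IHs ?shift_same ?shift_other.
rewrite -(rank_other b) //; have [ac|ac] := eqVneq a c.
  rewrite -{c}ac in bc IHs Ic *.
  case: l Ic => [|l] Ic.
    by rewrite (negPf Ic) /= eqxx (negPf ab) /rank big_ord0.
  rewrite rankS //.
  by case: ifP => _; rewrite /= ?(negPf ab) ?eqxx IHs ?shift_same ?shift_other.
rewrite -(rank_other c) //.
by case: ifP => _; rewrite /= ?(negPf ab) ?(negPf ac) IHs ?shift_other.
Qed.

(** [rank] grows by at most one per step and so skips no value: every copy in [del I s] comes from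
    an unmarked copy of [s]. *)
Lemma rank_surj I b n k : k < rank I b n ->
  exists j, [/\ j < n, ~~ I b j & rank I b j = k].
Proof.
elim: n => [|n IHn]; first by rewrite /rank big_ord0.
rewrite {1}/rank big_ord_recr /= -/(rank I b n).
have [lt_k _|le_k] := ltnP k (rank I b n).
  by have [j [jn Ij <-]] := IHn lt_k; exists j; split=> //; apply: ltnW.
case In: (I b n); first by rewrite addn0 ltnNge le_k.
rewrite addn1 ltnS => k_le; exists n; rewrite In; split=> //.
by apply/eqP; rewrite eqn_leq le_k k_le.
Qed.

Lemma del_inj I s t :
  (forall b, count_mem b s = count_mem b t) ->
  (forall b j c l, b != c -> j < count_mem b s -> l < count_mem c s ->
     ~~ I b j -> ~~ I c l -> before s b j c l = before t b j c l) ->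
  del I s = del I t.
Proof.
move=> cnt eq_before; apply: before_inj => [b|b j c l bc].
  by rewrite !count_del cnt.
rewrite !count_del => /rank_surj[j' [jb Ij <-]] /rank_surj[l' [lc Il <-]].
by rewrite !before_del // eq_before.
Qed.

End Words.

(** [s] is built from the left, by induction on the number of copies still to be placed. A letter
    whose next copy is marked can be placed at once, since deletion removes it; if there is none,
    the first letter of [u] is placed. *)
Lemma del_surj (T : finType) (I : T -> pred nat) (cnt : T -> nat) u :
  (forall b, count_mem b u = rank I b (cnt b)) ->
  exists2 s, (forall b, count_mem b s = cnt b) & del I s = u.
Proof.
have [N] := ubnP (\sum_b cnt b); elim: N I cnt u => // N IHN I cnt u lt_N cnt_u.
have step a u' : 0 < cnt a ->
    (forall b, count_mem b u' = rank (shift a I) b (cnt b - (a == b))) ->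
    exists2 s, (forall b, count_mem b (a :: s) = cnt b) & del (shift a I) s = u'.
  move=> a_gt0 cnt_u'.
  have [|s cnt_s del_s] := IHN (shift a I) (fun b => cnt b - (a == b)) u' _ cnt_u'.
    rewrite -ltnS (leq_trans _ lt_N) // ltnS.
    rewrite (bigD1 a) //= [ltnRHS](bigD1 a) //= eqxx subn1.
    by rewrite -addSn prednK // leq_add2l leq_sum // => b ba; rewrite leq_subr.
  exists s => //= b; rewrite cnt_s.
  by case: eqVneq => [<-|_]; rewrite ?subn0 // add1n subn1 prednK.
have cnt_shift a b : 0 < cnt a ->
    count_mem b u = ((a == b) && ~~ I b 0) + rank (shift a I) b (cnt b - (a == b)).
  move=> a_gt0; rewrite cnt_u -rank_shift subnKC //.
  by case: eqVneq => // <-.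
have [a /andP[a_gt0 Ia]|no_del] := pickP (fun a => (0 < cnt a) && I a 0).
  have [b|s cnt_s del_s] := step a u a_gt0.
    by rewrite (cnt_shift a) //; case: eqVneq => [<-|//]; rewrite Ia.
  by exists (a :: s) => //=; rewrite Ia.
have Igt0 b : 0 < cnt b -> ~~ I b 0.
  by move=> b_gt0; have := no_del b; rewrite b_gt0 /= => ->.
case: u cnt_u cnt_shift => [|a u] cnt_u cnt_shift.
  (* With [u] empty no copy can be left: the next one would be unmarked and would have to occur in
     [u]. *)
  exists [::] => // b; apply/esym/eqP; rewrite -leqn0 leqNgt; apply/negP => b_gt0.
  have := cnt_u b; rewrite /rank /=; have := Igt0 b b_gt0.
  by case: (cnt b) b_gt0 => // k _ Ib; rewrite big_ord_recl /= Ib.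
have a_gt0 : 0 < cnt a.
  have := cnt_u a; rewrite /= eqxx; case: (cnt a) => //.
  by rewrite /rank big_ord0.
have [b|s cnt_s del_s] := step a u a_gt0.
  have := cnt_shift a b a_gt0 => /=; have [<-|_] := eqVneq a b; last by [].
  by rewrite Igt0 // => /addnI.
by exists (a :: s) => //=; rewrite (negPf (Igt0 a a_gt0)) del_s.
Qed.

(** * Words fixed by a product of promotions *)

Definition act (T : eqType) (u : seq (T * nat)) (s : seq T) :=
  foldr (fun o s => promote o.1 o.2 s) s u.

Lemma act_cons (T : eqType) (b : T) j u s :
  act ((b, j) :: u) s = promote b j (act u s).
Proof. by []. Qed.

Section FixedWords.

Variables (T : eqType) (cnt : T -> nat).
Implicit Types (b c : T) (s t : seq T) (u : seq (T * nat)).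

Let content s := forall b, count_mem b s = cnt b.
Let valid u := forall o, o \in u -> o.2 < cnt o.1.

Lemma content_act u s : valid u -> content s -> content (act u s).
Proof.
move=> + cnt_s; elim: u => //= o v IHv v_cnt b.
have cnt_v : content (act v s).
  by apply: IHv => o' vo'; apply: v_cnt; rewrite inE vo' orbT.
rewrite -(cnt_v b); apply/seq.permP/perm_promote.
by rewrite cnt_v v_cnt // inE eqxx.
Qed.

(** A promotion alters only comparisons that involve the promoted copy. *)
Lemma before_act_notin u s b j c l : valid u -> content s ->
  b != c -> j < cnt b -> l < cnt c -> (b, j) \notin u -> (c, l) \notin u ->
  before (act u s) b j c l = before s b j c l.
Proof.
move=> u_cnt cnt_s bc jb lc; elim: u u_cnt => //= -[a i] u IHu u_cnt.
have u_cnt' : valid u by move=> o uo; apply: u_cnt; rewrite inE uo orbT.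
have cnt_u := content_act u_cnt' cnt_s.
have ia : i < cnt a by apply: (u_cnt (a, i)); rewrite inE eqxx.
rewrite !inE !negb_or => /andP[ba bu] /andP[ca cu]; rewrite -IHu //=.
have [ab|ab] := eqVneq a b.
  rewrite ab in ia ba *; rewrite before_promote ?cnt_u //.
  by case: (eqVneq j i) ba => [->|]; rewrite ?eqxx.
have [ac|ac] := eqVneq a c; last by rewrite before_promote_other ?cnt_u.
rewrite ac in ia ca *; rewrite before_promote_sym ?cnt_u //.
by case: (eqVneq l i) ca => [->|]; rewrite ?eqxx.
Qed.

(* Promoting copy [j] of [b] copies the comparisons of copy [j - 1] onto copy
   [j], so every comparison in [act u s] is read off from [s] at smaller
   indices, or comes from a move to the front. *)
Lemma before_act u b j c l : valid u -> b != c -> j < cnt b -> l < cnt c ->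
  (exists v, forall s, content s -> before (act u s) b j c l = v) \/
  (exists j' l', [/\ j' <= j, l' <= l,
     ((b, j) \in u) || ((c, l) \in u) -> j' + l' < j + l &
     forall s, content s -> before (act u s) b j c l = before s b j' c l']).
Proof.
move=> + bc; elim: u j l => [|[a i] u IHu] j l u_cnt jb lc.
  by right; exists j, l; split.
have u_cnt' : valid u by move=> o uo; apply: u_cnt; rewrite inE uo orbT.
have cnt_u s : content s -> content (act u s) by apply: content_act.
have ia : i < cnt a by apply: (u_cnt (a, i)); rewrite inE eqxx.
have [/eqP[ab ji]|bj] := boolP ((b, j) == (a, i)).
  subst a i; case: j u_cnt ia jb => [|j] u_cnt ia jb.
    by left; exists true => s cs; rewrite act_cons before_promote ?cnt_u.
  have E s : content s ->
      before (promote b j.+1 (act u s)) b j.+1 c l = before (act u s) b j c l.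
    by move=> cs; rewrite before_promote ?cnt_u // eqxx.
  have [[v Ev]|[j' [l' [jj ll _ Ejl]]]] := IHu j l u_cnt' (ltnW jb) lc.
    by left; exists v => s cs; rewrite act_cons E ?Ev.
  right; exists j', l'; split=> [|//||s cs]; last by rewrite act_cons E ?Ejl.
    exact: leqW.
  by move=> _; rewrite addSn ltnS leq_add.
have [/eqP[ac li]|cl] := boolP ((c, l) == (a, i)).
  subst a i; case: l u_cnt ia bj lc => [|l] u_cnt ia bj lc.
    by left; exists false => s cs; rewrite act_cons before_promote_sym ?cnt_u.
  have E s : content s ->
      before (promote c l.+1 (act u s)) b j c l.+1 = before (act u s) b j c l.
    by move=> cs; rewrite before_promote_sym ?cnt_u // eqxx.
  have [[v Ev]|[j' [l' [jj ll _ Ejl]]]] := IHu j l u_cnt' jb (ltnW lc).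
    by left; exists v => s cs; rewrite act_cons E ?Ev.
  right; exists j', l'; split=> [//|||s cs]; last by rewrite act_cons E ?Ejl.
    exact: leqW.
  by move=> _; rewrite addnS ltnS leq_add.
have E s : content s ->
    before (promote a i (act u s)) b j c l = before (act u s) b j c l.
  move=> cs; have u1 : valid [:: (a, i)] by move=> o; rewrite inE => /eqP->.
  by rewrite -(before_act_notin u1 (cnt_u s cs) bc jb lc) ?inE.
have [[v Ev]|[j' [l' [jj ll lt_jl Ejl]]]] := IHu j l u_cnt' jb lc.
  by left; exists v => s cs; rewrite act_cons E ?Ev.
right; exists j', l'; split=> // [|s cs]; last by rewrite act_cons E ?Ejl.
by rewrite !inE (negPf bj) (negPf cl).
Qed.

Variables (u : seq (T * nat)) (u_cnt : valid u).
Let I b : pred nat := fun j => (b, j) \in u.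

(** Induction on the index sum [j + l] of a comparison. Two unpromoted copies compare as in
    [del I s]. Otherwise [s] is replaced by [act u s], and [before_act] yields a constant or a
    comparison in [s] with smaller index sum. *)
Lemma fixed_del_inj s t : content s -> content t -> act u s = s -> act u t = t ->
  del I s = del I t -> s = t.
Proof.
move=> cs ct fs ft eq_del; apply: before_inj => [b|b j c l bc]; first by rewrite cs ct.
rewrite !cs; have [N] := ubnP (j + l); elim: N j l => // N IHN j l lt_N jb lc.
have [/norP[bj cl]|u_bc] := boolP (~~ (((b, j) \in u) || ((c, l) \in u))).
  by rewrite -(before_del (I := I) s) // -(before_del (I := I) t) // eq_del.
rewrite -fs -ft; have [[v Ev]|[j' [l' [jj ll lt_jl Ejl]]]] := before_act u_cnt bc jb lc.
  by rewrite !Ev.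
rewrite !Ejl //; apply: IHN; try exact: leq_ltn_trans jb; try exact: leq_ltn_trans lc.
exact: leq_trans (lt_jl (negbNE u_bc)) _.
Qed.

Lemma del_act s : content s -> del I (act u s) = del I s.
Proof.
move=> cs; apply: del_inj => [b|b j c l bc].
  by rewrite (content_act u_cnt cs) cs.
by rewrite !(content_act u_cnt cs) => *; apply: before_act_notin.
Qed.

(** Iterating [act u] keeps the subword of unpromoted copies and reaches a fixed word, since the
    comparisons become stationary in the order of their index sums. *)
Lemma fixed_del_surj s : content s ->
  exists t, [/\ content t, act u t = t & del I t = del I s].
Proof.
move=> cs.
have iterP n : content (iter n (act u) s) /\
    del I (iter n (act u) s) = del I s.
  by elim: n => [|n [cn dn]] //=; rewrite del_act //; split=> //; apply: content_act.
have stable n b j c l : b != c -> j < cnt b -> l < cnt c -> j + l < n ->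
    before (iter n.+1 (act u) s) b j c l = before (iter n (act u) s) b j c l.
  move=> bc; elim: n j l => // n IHn j l jb lc lt_n.
  have [/norP[bj cl]|u_bc] := boolP (~~ (((b, j) \in u) || ((c, l) \in u))).
    by rewrite iterS before_act_notin //; have [] := iterP n.+1.
  have [cn _] := iterP n; have [cn1 _] := iterP n.+1.
  rewrite iterS [in RHS]iterS.
  have [[v Ev]|[j' [l' [jj ll lt_jl Ejl]]]] := before_act u_cnt bc jb lc.
    by rewrite !Ev.
  rewrite !Ejl //; apply: IHn; try exact: leq_ltn_trans jb; try exact: leq_ltn_trans lc.
  exact: leq_trans (lt_jl (negbNE u_bc)) _.
(* Copies have indices below [size s], so this number of iterations exceeds every [j + l] and
   settles all comparisons. *)
have [cN dN] := iterP (size s + size s).+1.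
exists (iter (size s + size s).+1 (act u) s); split=> //.
have [cN1 _] := iterP (size s + size s).+2.
apply: before_inj => [b|b j c l bc]; rewrite -?iterS ?cN ?cN1 // => jb lc.
apply: stable => //; rewrite ltnS leq_add //.
  by rewrite (leq_trans (ltnW jb)) // -cs count_size.
by rewrite (leq_trans (ltnW lc)) // -cs count_size.
Qed.

End FixedWords.

(** * Counting words through their letter sequences *)

Lemma card_eq_image (T1 T2 : finType) (V : eqType) (A : {set T1}) (B : {set T2})
    (f : T1 -> V) (g : T2 -> V) :
  {in A &, injective f} -> {in B &, injective g} ->
  (forall x, x \in A -> exists2 y, y \in B & g y = f x) ->
  (forall y, y \in B -> exists2 x, x \in A & f x = g y) ->
  #|A| = #|B|.
Proof.
move=> f_inj g_inj fg gf; rewrite !cardE -(size_map f) -(size_map g).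
apply/perm_size/uniq_perm.
- by rewrite map_inj_in_uniq ?enum_uniq // => x y; rewrite !mem_enum; apply: f_inj.
- by rewrite map_inj_in_uniq ?enum_uniq // => x y; rewrite !mem_enum; apply: g_inj.
move=> v; apply/mapP/mapP => -[x]; rewrite mem_enum => xA ->.
  by have [y yB <-] := fg x xA; exists y; rewrite ?mem_enum.
by have [y yB <-] := gf x xA; exists y; rewrite ?mem_enum.
Qed.

Lemma size_sum_count (T : finType) (s : seq T) : size s = \sum_b count_mem b s.
Proof.
elim: s => [|a s IHs]; first by rewrite big1.
rewrite /= big_split /= -IHs (bigD1 a) //= eqxx big1 // => b.
by rewrite eq_sym => /negPf->.
Qed.

Lemma count_map_sum (E : finType) (T : eqType) (S : {set E}) (h : E -> T) b :
  count_mem b [seq h e | e <- enum S] = \sum_(e in S) (h e == b).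
Proof.
rewrite count_map -sum1_count big_enum_cond /= big_mkcondr.
by apply: eq_bigr => e _; case: (h e == b).
Qed.

Section Content.

Variables (m : nat).
Implicit Types n k : 'I_m -> nat.

Lemma letters_inj n : injective (@letters m n).
Proof. by move=> w w' /val_inj/val_inj. Qed.

Lemma count_letters n (w : word n) b : count_mem b (letters w) = n b.
Proof. by have /forallP/(_ b)/eqP := valP w. Qed.

Lemma word_of_seq n (s : seq 'I_m) :
  (forall b, count_mem b s = n b) -> exists w : word n, letters w = s.
Proof.
move=> cnt_s; have size_s : size s == \sum_b n b.
  by rewrite size_sum_count; apply/eqP/eq_bigr => b _; apply: cnt_s.
have s_n : has_content n (Tuple size_s) by apply/forallP => b /=; rewrite cnt_s.
by exists (exist _ (Tuple size_s) s_n).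
Qed.

(** Pointwise equal contents still give two types of words, so the derangements are matched through
    their letter sequences. *)
Lemma eq_num_derangements n k : n =1 k -> num_derangements n = num_derangements k.
Proof.
move=> nk; have sorted_nk : sorted_word n = sorted_word k.
  by congr flatten; apply: eq_map => i; rewrite nk.
apply: (card_eq_image (f := @letters m n) (g := @letters m k)).
- exact: in2W (@letters_inj n).
- exact: in2W (@letters_inj k).
- move=> w; rewrite inE /derangement sorted_nk => dw.
  have [b|v vE] := @word_of_seq k (letters w); first by rewrite count_letters.
  by exists v; rewrite ?inE /derangement vE.
- move=> w; rewrite inE /derangement -sorted_nk => dw.
  have [b|v vE] := @word_of_seq n (letters w); first by rewrite count_letters.
  by exists v; rewrite ?inE /derangement vE.
Qed.

End Content.

(** * Words on a set of copies and their derangements *)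

Section Copies.

Variables (m : nat) (n : 'I_m -> nat).

Notation copy := {b : 'I_m & 'I_(n b)}.
Implicit Types (e : copy) (S A : {set copy}) (b : 'I_m).

Definition cont S b : nat := \sum_(j < n b) (Tagged (fun b => 'I_(n b)) j \in S).

Lemma contE S b : cont S b = \sum_(e in S) (tag e == b).
Proof.
rewrite big_mkcond /= /cont.
rewrite (eq_bigr (fun e : copy => (e \in S) && (tag e == b) : nat)); last first.
  by move=> e _; case: ifP.
transitivity (\sum_(a < m) \sum_(j < n a)
    ((Tagged (fun b => 'I_(n b)) j \in S) && (a == b) : nat)).
  rewrite (bigD1 b) //= [X in _ = _ + X]big1 ?addn0; last first.
    by move=> a /negPf ab; rewrite big1 // => j _; rewrite ab andbF.
  by apply: eq_bigr => j _; rewrite eqxx andbT.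
by rewrite sig_big_dep /=; apply: eq_bigr => -[].
Qed.

(** The enumeration of all copies is grouped by letters in their order, so selecting the members of
    [S] leaves a block of [cont S i] copies for each letter [i]. *)
Lemma sorted_word_cont S : sorted_word (cont S) = [seq tag e | e <- enum S].
Proof.
have -> : enum S = [seq e <- flatten [seq
    [seq Tagged (fun b => 'I_(n b)) j | j <- enum 'I_(n i)]
    | i <- enum 'I_m] | e \in S].
  rewrite enumT; under [in RHS]eq_map do rewrite enumT.
  by rewrite /enum_mem; congr filter; rewrite [in LHS]unlock.
rewrite filter_flatten map_flatten -2!map_comp; congr flatten; apply: eq_map => i /=.
rewrite filter_map -map_comp /=.
have all_i (s : seq 'I_(n i)) :
    [seq tag (Tagged (fun b => 'I_(n b)) j) | j <- s] = nseq (size s) i.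
  by elim: s => //= j s ->.
rewrite [RHS]all_i size_filter -sum1_count big_enum_cond big_mkcond /=.
by congr nseq; apply: eq_bigr => j _; case: (_ \in S).
Qed.

(* [enum S] lists the positions of the sorted word, so that words of content
   [cont S] become functions on [S]. *)
Definition letter_at S (w : word (cont S)) e : 'I_m :=
  nth (tag e) (letters w) (index e (enum S)).

Lemma size_letters S (w : word (cont S)) : size (letters w) = #|S|.
Proof.
rewrite size_sum_count (eq_bigr (cont S)); last by move=> b _; rewrite count_letters.
rewrite cardE -(size_map (fun e : copy => tag e)) size_sum_count.
by apply: eq_bigr => b _; rewrite count_map_sum contE.
Qed.

Lemma lettersE S (w : word (cont S)) :
  letters w = [seq letter_at w e | e <- enum S].
Proof.
case E: (enum S) => [|e0 l].
  by apply/nilP; rewrite /nilp size_letters cardE E.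
apply: (@eq_from_nth _ (tag e0)); first by rewrite size_map size_letters cardE E.
move=> i; rewrite size_letters cardE -E => iS.
rewrite (nth_map e0) // /letter_at index_uniq ?enum_uniq //.
by apply: set_nth_default; rewrite size_letters cardE.
Qed.

Lemma word_of_fun S (h : copy -> 'I_m) :
  (forall b, \sum_(e in S) (h e == b) = cont S b) ->
  exists2 w : word (cont S), letters w = [seq h e | e <- enum S]
    & {in S, letter_at w =1 h}.
Proof.
move=> cnt_h; have [b|w wE] := @word_of_seq _ (cont S) [seq h e | e <- enum S].
  by rewrite count_map_sum.
exists w => // e eS; rewrite /letter_at wE (nth_map e) ?index_mem ?mem_enum //.
by rewrite nth_index ?mem_enum.
Qed.

Lemma sum_letter_at S (w : word (cont S)) b :
  \sum_(e in S) (letter_at w e == b) = cont S b.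
Proof. by rewrite -count_map_sum -lettersE count_letters. Qed.

Lemma derangementE S (w : word (cont S)) :
  derangement w = [forall e in S, letter_at w e != tag e].
Proof.
rewrite /derangement sorted_word_cont lettersE.
transitivity (all (fun e => letter_at w e != tag e) (enum S)).
  by elim: (enum S) => //= e s ->.
by apply/allP/forall_inP => H e eS; apply: H; rewrite ?mem_enum // -mem_enum.
Qed.

Definition mismatches S (w : word (cont S)) : {set copy} :=
  [set e in S | letter_at w e != tag e].

(** Such a word agrees with the sorted one off [A], so its restriction to [A] determines it and is a
    derangement. Conversely, a derangement on [A] extends by [tag] to [S]. *)
Lemma card_mismatches S A : A \subset S ->
  #|[set w : word (cont S) | mismatches w == A]| = num_derangements (cont A).
Proof.
(* Positions off [A] where [h] is [tag] contribute equally to both contents, so [h] has content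
   [cont S] on [S] exactly when it has content [cont A] on [A]. *)
move=> AS; have sum_split (h : copy -> 'I_m) b :
    (forall e, e \in S -> e \notin A -> h e = tag e) ->
    \sum_(e in S) (h e == b) + cont A b = \sum_(e in A) (h e == b) + cont S b.
  move=> hA; rewrite !contE (big_setID A) [X in _ = _ + X](big_setID A) /=.
  rewrite (setIidPr AS) addnAC addnA; congr (_ + _ + _).
  by apply: eq_bigr => e; rewrite inE => /andP[eA eS]; rewrite hA.
have outA (w : word (cont S)) : mismatches w = A ->
    forall e, e \in S -> e \notin A -> letter_at w e = tag e.
  by move=> <- e eS; rewrite inE eS /= negbK => /eqP.
apply: (card_eq_image (f := fun w => [seq letter_at w e | e <- enum A])
                      (g := @letters m (cont A))).
- move=> w w'; rewrite !inE => /eqP wA /eqP w'A /eq_in_map eq_ww'.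
  apply: letters_inj; rewrite !lettersE; apply/eq_in_map => e; rewrite mem_enum => eS.
  have [eA|eA] := boolP (e \in A); first by apply: eq_ww'; rewrite mem_enum.
  by rewrite !outA.
- exact: in2W (@letters_inj _ _).
- move=> w; rewrite inE => /eqP wA.
  have [b|v vE vh] := @word_of_fun A (letter_at w).
    have /eqP := sum_split _ b (outA w wA).
    by rewrite sum_letter_at addnC eqn_add2r => /eqP.
  exists v => //; rewrite inE derangementE; apply/forall_inP => e eA.
  by rewrite vh //; move: eA; rewrite -wA inE => /andP[].
- move=> v; rewrite inE derangementE => /forall_inP v_der.
  pose h e := if e \in A then letter_at v e else tag e.
  have [b|w wE wh] := @word_of_fun S h.
    have hA e : e \in S -> e \notin A -> h e = tag e by rewrite /h => _ /negPf->.
    have sumA : \sum_(e in A) (h e == b) = cont A b.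
      by rewrite -(sum_letter_at v); apply: eq_bigr => e eA; rewrite /h eA.
    by apply/eqP; rewrite -(eqn_add2r (cont A b)) sum_split // sumA addnC.
  exists w.
    rewrite inE; apply/eqP/setP => e; rewrite inE.
    have [eS|eS] := boolP (e \in S); last by rewrite (contraNF (subsetP AS e)).
    by rewrite wh // /h; case: ifP => [/v_der->|]; rewrite ?eqxx.
  rewrite lettersE; apply/eq_in_map => e; rewrite mem_enum => eA.
  by rewrite wh /h ?eA // (subsetP AS).
Qed.

(* Splitting a word into the positions where it agrees with the sorted word
   and a derangement of the remaining ones. *)
Lemma card_word_derangements S :
  #|{: word (cont S)}| = \sum_(A : {set copy} | A \subset S) num_derangements (cont A).
Proof.
rewrite -sum1_card (partition_big (@mismatches S) (fun A => A \subset S)) /=.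
  apply: eq_bigr => A AS; rewrite -(card_mismatches AS) -sum1_card.
  by apply: eq_bigl => w; rewrite inE.
by move=> w _; apply/subsetP => e; rewrite inE => /andP[].
Qed.

(** * Number of fixed words of a product of operators *)

Definition word_act (t : seq copy) (w : word n) : word n :=
  foldr (fun e v => partial (tagged e) v) w t.

Definition ops (t : seq copy) : seq ('I_m * nat) :=
  [seq (tag e, val (tagged e)) | e <- t].

Lemma letters_word_act t w : letters (word_act t w) = act (ops t) (letters w).
Proof. by elim: t => // e t IHt; rewrite [ops _]/= act_cons -IHt. Qed.

Lemma mem_ops t b (j : 'I_(n b)) :
  ((b, val j) \in ops t) = (Tagged (fun b => 'I_(n b)) j \in t).
Proof.
have copy_inj : injective (fun e : copy => (tag e, val (tagged e))).
  by move=> [a i] [c l] /= [ac]; subst c => /val_inj->.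
exact: (mem_map copy_inj t (Tagged (fun b => 'I_(n b)) j)).
Qed.

(** Deleting the copies promoted in [t] is the bijection. For surjectivity, [del_surj] gives some
    word with the required subword, and [fixed_del_surj] replaces it by a fixed one with the same
    subword. *)
Lemma card_fixed_words t :
  #|[set w | word_act t w == w]| = #|{: word (cont (~: [set e in t]))}|.
Proof.
pose I b : pred nat := fun j => (b, j) \in ops t.
have rankE b : rank I b (n b) = cont (~: [set e in t]) b.
  by apply: eq_bigr => j _; rewrite /I mem_ops !inE.
have t_cnt o : o \in ops t -> o.2 < n o.1.
  by case/mapP => -[b j] _ ->; apply: ltn_ord.
rewrite -cardsT.
apply: (card_eq_image (f := fun w => del I (letters w)) (g := @letters m _)).
- move=> w w'; rewrite !inE => /eqP fw /eqP fw' eq_del; apply: letters_inj.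
  apply: (fixed_del_inj t_cnt) eq_del; try exact: count_letters.
  - by rewrite -letters_word_act fw.
  - by rewrite -letters_word_act fw'.
- exact: in2W (@letters_inj _ _).
- move=> w _.
  have [b|v vE] := @word_of_seq _ (cont (~: [set e in t])) (del I (letters w)).
    by rewrite count_del count_letters rankE.
  by exists v.
- move=> v _; have [b|s cnt_s del_s] := @del_surj _ I n (letters v).
    by rewrite count_letters rankE.
  have [s' [cnt_s' fs' del_s']] := fixed_del_surj t_cnt cnt_s.
  have [w wE] := word_of_seq cnt_s'.
  exists w; last by rewrite wE del_s'.
  by rewrite inE; apply/eqP/letters_inj; rewrite letters_word_act wE.
Qed.

End Copies.

Local Open Scope ring_scope.

(** * Characteristic polynomials and traces of powers *)

Lemma deriv_prod (R : comNzRingType) (I : finType) (F : I -> {poly R}) (s : seq I) :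
  uniq s ->
  (\prod_(i <- s) F i)^`()
    = \sum_(i <- s) (F i)^`() * \prod_(j <- s | i != j) F j.
Proof.
elim: s => [|i s IHs] /= => [_|/andP[si us]].
  by rewrite !big_nil -[1]/(1%:P) derivC.
rewrite !big_cons derivM IHs // eqxx mulr_sumr; congr (_ + _).
  rewrite big_seq [in RHS]big_seq_cond; congr (_ * _); apply: eq_bigl => j.
  by case: eqVneq => [<-|_]; rewrite ?andbF ?andbT ?(negPf si).
apply: eq_big_seq => j sj; rewrite big_cons.
by have [ji|_] := eqVneq j i; [rewrite -ji sj in si | rewrite mulrCA].
Qed.

Lemma sign_polyC (R : nzRingType) n : (-1) ^+ n = ((-1) ^+ n)%:P :> {poly R}.
Proof. by rewrite rmorphXn rmorphN1. Qed.

(** Jacobi's formula. In the expansion over permutations, the derivative of the factor in row [i] is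
    1 if [s i = i] and 0 otherwise; the permutations fixing [i] add up to the diagonal cofactor. *)
Lemma deriv_char_poly (R : comNzRingType) n (A : 'M[R]_n) :
  (char_poly A)^`() = \tr (\adj (char_poly_mx A)).
Proof.
rewrite /char_poly /determinant raddf_sum.
transitivity (\sum_(s : 'S_n) \sum_i
    if s i == i then (-1) ^+ s * \prod_(j | i != j) char_poly_mx A j (s j)
    else 0).
  apply: eq_bigr => s _.
  rewrite sign_polyC mul_polyC /= derivZ deriv_prod ?index_enum_uniq //.
  rewrite scaler_sumr; apply: eq_bigr => i _.
  rewrite !mxE derivB derivC subr0 eq_sym.
  have [si|_] := eqVneq (s i) i; last by rewrite mulr0n linear0 mul0r scaler0.
  by rewrite mulr1n derivX mul1r -mul_polyC.
rewrite exchange_big; apply: eq_bigr => i _.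
by rewrite mxE expand_cofactor -big_mkcond.
Qed.

Lemma size_sum_leq (R : nzRingType) (I : Type) (s : seq I) (P : pred I)
    (F : I -> {poly R}) d :
  (forall i, P i -> (size (F i) <= d)%N) -> (size (\sum_(i <- s | P i) F i)%R <= d)%N.
Proof.
move=> Fd; apply: (big_ind (fun p : {poly R} => size p <= d)%N) => //.
  by rewrite size_poly0.
by move=> p q pd qd; rewrite (leq_trans (size_polyD _ _)) // geq_max pd.
Qed.

Lemma size_det_leq (R : comNzRingType) n (M : 'M[{poly R}]_n) :
  (forall i j, size (M i j) <= 2)%N -> (size (\det M) <= n.+1)%N.
Proof.
move=> M2; apply: size_sum_leq => s _.
rewrite sign_polyC mul_polyC.
apply: leq_trans (size_scale_leq _ _) _; apply: leq_trans (size_poly_prod_leq _ _) _.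
rewrite leq_subLR cardT size_enum_ord addnS ltnS.
apply: leq_trans (leq_sum _ (fun i _ => M2 i (s i))) _.
by rewrite sum_nat_const card_ord muln2 addnn.
Qed.

Lemma size_adj_char_poly_mx (R : comNzRingType) n (A : 'M[R]_n) i j :
  (size (\adj (char_poly_mx A) i j) <= n)%N.
Proof.
case: n A i j => [|n] A i j; first by case: i.
rewrite mxE /cofactor sign_polyC mul_polyC.
apply: leq_trans (size_scale_leq _ _) _; apply: size_det_leq => k l.
rewrite !mxE; case: eqP => _; rewrite ?mulr1n ?mulr0n ?size_XsubC //.
by rewrite sub0r size_polyN (leq_trans (size_polyC_leq1 _)).
Qed.

(* The polynomial part of ['X^k * p^`() / p] when the [t i] are the power sums
   of the roots of [p]. *)
Definition power_sum_poly (R : nzRingType) (t : nat -> R) (k : nat) : {poly R} :=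
  \sum_(i < k) 'X^(k.-1 - i) * (t i)%:P.

(** A form of Newton's identities. Factoring ['X - B] out of ['X^k - B ^+ k], multiplying by the
    adjugate and taking traces shows that the difference is the trace of [\adj M *m B ^+ k]. The
    constant matrix [B ^+ k] does not raise the size bound of the adjugate. *)
Lemma size_char_poly_power_sum (R : comNzRingType) n (A : 'M[R]_n) k :
  (size ('X^k * (char_poly A)^`()
         - char_poly A * power_sum_poly (fun i => \tr (A ^+ i)) k)%R <= n)%N.
Proof.
set M := char_poly_mx A; set B := map_mx (@polyC R) A.
have BX i : B ^+ i = map_mx (@polyC R) (A ^+ i).
  elim: i => [|i IHi]; first by rewrite !expr0 map_mx1.
  by rewrite !exprS IHi -!mulmxE map_mxM.
have XX i : ('X%:M : 'M[{poly R}]_n) ^+ i = ('X^i)%:M.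
  elim: i => [|i IHi]; first by rewrite !expr0.
  by rewrite !exprS IHi -!mulmxE -scalar_mxM.
have comXB : GRing.comm ('X%:M : 'M[{poly R}]_n) B.
  by rewrite /GRing.comm -!mulmxE scalar_mxC.
have tr_adj : \tr (\adj M *m ('X^k)%:M) - \tr (\adj M *m B ^+ k)
    = char_poly A * power_sum_poly (fun i => \tr (A ^+ i)) k.
  rewrite -linearB -mulmxBr -XX subrXX_comm // -mulmxE mulmxA mul_adj_mx.
  rewrite mul_scalar_mx linearZ /= linear_sum; congr (_ * _).
  apply: eq_bigr => i _; rewrite XX BX /= mul_scalar_mx linearZ /=.
  by rewrite -trace_map_mx.
rewrite deriv_char_poly -tr_adj mul_mx_scalar linearZ /= opprB addrC subrK.
apply: size_sum_leq => i _; rewrite mxE; apply: size_sum_leq => j _.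
rewrite BX [X in _ * X]mxE mulrC mul_polyC.
by apply: leq_trans (size_scale_leq _ _) (size_adj_char_poly_mx _ _ _).
Qed.

(** Induction on the roots: by the geometric sum [D], a new root [a] turns the remainder [E] into
    [('X - a%:P) * E + (a ^+ k)%:P * q]. *)
Lemma size_prod_XsubC_power_sum (R : comNzRingType) (r : seq R) k :
  let q := \prod_(a <- r) ('X - a%:P) in
  (size ('X^k * q^`()
         - q * power_sum_poly (fun i => \sum_(a <- r) a ^+ i) k)%R <= size r)%N.
Proof.
elim: r => [|a r /=]; rewrite /power_sum_poly.
  rewrite !big_nil -[1]/(1%:P) derivC mulr0 sub0r mul1r size_polyN.
  by rewrite big1 ?size_poly0 // => i _; rewrite big_nil mulr0.
set q := \prod_(b <- r) _; set S := \sum_(i < k) _ => IHr.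
rewrite big_cons -/q derivM derivXsubC mul1r.
have -> : \sum_(i < k) 'X^(k.-1 - i) * (\sum_(b <- a :: r) b ^+ i)%:P
    = \sum_(i < k) 'X^(k.-1 - i) * a%:P ^+ i + S.
  rewrite -big_split; apply: eq_bigr => i _ /=.
  by rewrite big_cons polyCD mulrDr rmorphXn.
set D := \sum_(i < k) _; have XaD : ('X - a%:P) * D = 'X^k - (a ^+ k)%:P.
  by rewrite -subrXX rmorphXn.
have -> : 'X^k * (q + ('X - a%:P) * q^`()) - ('X - a%:P) * q * (D + S)
    = ('X - a%:P) * ('X^k * q^`() - q * S) + (a ^+ k)%:P * q.
  transitivity ('X^k * q - ('X - a%:P) * D * q
                + ('X - a%:P) * ('X^k * q^`() - q * S)); first by ring.
  by rewrite XaD; ring.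
apply: leq_trans (size_polyD _ _) _; rewrite geq_max; apply/andP; split.
  apply: leq_trans (size_polyMleq _ _) _; rewrite size_XsubC /=.
  by rewrite ltnS.
rewrite mul_polyC; apply: leq_trans (size_scale_leq _ _) _.
by rewrite size_prod_XsubC.
Qed.

Lemma coefM_top (R : nzSemiRingType) (p q : {poly R}) a b :
  (size p <= a.+1)%N -> (size q <= b.+1)%N -> (p * q)`_(a + b) = p`_a * q`_b.
Proof.
move=> pa qb; rewrite coefM.
rewrite (bigD1 (Ordinal (leq_addr b a : (a < (a + b).+1)%N))) //= addKn big1 ?addr0 //.
move=> i; rewrite -val_eqE /= neq_ltn => /orP[i_lt|lt_i].
  rewrite [q`__]nth_default ?mulr0 // (leq_trans qb) //.
  by rewrite ltn_subRL [ltnLHS]addnC [leqRHS]addnC ltn_add2l.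
by rewrite [p`__]nth_default ?mul0r // (leq_trans pa).
Qed.

(* With [q] the right-hand side, the size of ['X^k * (p^`() * q - p * q^`())] is
   bounded independently of [k], so the Wronskian vanishes. *)
Lemma char_poly_of_traces (R : numDomainType) n (A : 'M[R]_n) (r : seq R) :
  (forall k, \tr (A ^+ k) = \sum_(a <- r) a ^+ k) ->
  char_poly A = \prod_(a <- r) ('X - a%:P).
Proof.
move=> trA; have size_r : size r = n.
  (* Exponent 0 compares [n] with [size r] inside [R], which has characteristic 0. *)
  apply/eqP; rewrite -(eqr_nat R) -[n%:R](@mxtrace1 R n) -[1%:M]/(A ^+ 0) trA.
  by rewrite (eq_bigr (fun=> 1)) // big_const_seq count_predT -Monoid.iteropE.
set p := char_poly A; set q := \prod_(a <- r) _.
pose S := power_sum_poly (fun i => \sum_(a <- r) a ^+ i).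
have pS k : (size ('X^k * p^`() - p * S k)%R <= n)%N.
  have := size_char_poly_power_sum A k.
  by rewrite /power_sum_poly; under eq_bigr do rewrite trA.
have qS k : (size ('X^k * q^`() - q * S k)%R <= n)%N.
  by rewrite -size_r; apply: size_prod_XsubC_power_sum.
have p_monic : p \is monic by apply: char_poly_monic.
have q_monic : q \is monic by apply: monic_prod_XsubC.
have size_p : size p = n.+1 by apply: size_char_poly.
have size_q : size q = n.+1 by rewrite size_prod_XsubC size_r.
have wronskian : p^`() * q = p * q^`().
  apply/eqP; rewrite -subr_eq0; apply/negPn/negP => w0.
  (* [k] equals the size bound below, while ['X^k * w] with [w] nonzero has size above [k]. *)
  set w := _ - _ in w0; pose k := (n + n.+1)%N.
  have: (size ('X^k * w)%R <= n + n.+1)%N.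
    have -> : 'X^k * w = ('X^k * p^`() - p * S k) * q - p * ('X^k * q^`() - q * S k).
      by rewrite /w; ring.
    apply: leq_trans (size_polyD _ _) _; rewrite size_polyN geq_max.
    apply/andP; split; apply: leq_trans (size_polyMleq _ _) _.
      by apply: leq_trans (leq_pred _) _; rewrite size_q leq_add2r pS.
    apply: leq_trans (leq_pred _) _; rewrite size_p addnC.
    by rewrite leq_add2r qS.
  rewrite size_monicM ?monicXn // size_polyXn addSn /= leqNgt -/k.
  by rewrite -[X in (X < _)%N]addn0 ltn_add2l size_poly_gt0 w0.
apply/eqP; rewrite -subr_eq0; apply/negPn/negP => d0; set d := p - q in d0.
have size_d : (size d <= n)%N.
  apply/leq_sizeP => j; rewrite leq_eqVlt => /predU1P[<-|n_lt_j].
    have := monicP p_monic; have := monicP q_monic.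
    by rewrite !lead_coefE size_p size_q coefB /= => -> ->; rewrite subrr.
  by rewrite coefB !nth_default ?subrr // ?size_p ?size_q.
(* The degree [e] of [d] is below [n]. Comparing coefficients of degree [e + n] shows that [e] times
   and [n] times the leading coefficient of [d] agree, which is impossible in characteristic 0. *)
have Xd : ('X * d^`()) * q = d * ('X * q^`()).
  by rewrite -mulrA [RHS]mulrCA /d derivB !mulrBl wronskian [q * _]mulrC.
have size_Xderiv (u : {poly R}) : (size ('X * u^`())%R <= size u)%N.
  have [->|u0] := eqVneq u 0; first by rewrite deriv0 mulr0.
  by apply: leq_trans (size_polyMleq _ _) _; rewrite size_polyX lt_size_deriv.
have coef_Xderiv (u : {poly R}) i : ('X * u^`())`_i = u`_i *+ i.
  by case: i => [|i]; rewrite coefXM ?mulr0n //= coef_deriv.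
set e := (size d).-1; have size_de : size d = e.+1 by rewrite prednK ?size_poly_gt0.
have /esym := congr1 (coefp (e + n)%N) Xd; rewrite /= !coefM_top ?size_de //.
- rewrite !coef_Xderiv; have := monicP q_monic.
  rewrite lead_coefE size_q /= => ->; rewrite mulr1 mulrnAr mulr1 => /eqP.
  rewrite -subr_eq0 -mulrnBr; last by rewrite -ltnS -size_de (leq_trans size_d).
  rewrite mulrn_eq0 subn_eq0 leqNgt -ltnS -size_de ltnS size_d /=.
  by rewrite -lead_coefE lead_coef_eq0 (negPf d0).
- by rewrite -size_de size_Xderiv.
- by rewrite size_q.
- by rewrite -size_q size_Xderiv.
Qed.

(** * Traces of the powers of the transition matrix *)

Section Trace.

Variables (R : comNzRingType) (m : nat) (n : 'I_m -> nat).
Variable x : forall b : 'I_m, 'I_(n b) -> R.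

Notation copy := {b : 'I_m & 'I_(n b)}.
Implicit Types (e : copy) (t : seq copy) (A : {set copy}).

Let weight e := x (tagged e).

Fixpoint words_of_copies k : seq (seq copy) :=
  if k is k'.+1 then [seq e :: t | e <- enum {: copy}, t <- words_of_copies k']
  else [:: [::]].

Definition word_act_mx t : 'M[R]_#|{: word n}| :=
  \matrix_(p, q) (word_act t (enum_val q) == enum_val p)%:R.

Lemma word_act_mx_cons e t :
  word_act_mx (e :: t) = word_act_mx [:: e] *m word_act_mx t.
Proof.
apply/matrixP => p q; rewrite !mxE (bigD1 (enum_rank (word_act t (enum_val q)))) //=.
rewrite !mxE enum_rankK eqxx mulr1 /= big1 ?addr0 // => r r_neq; rewrite !mxE.
case: (word_act t (enum_val q) =P enum_val r) => [E|]; last by rewrite mulr0.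
by rewrite E enum_valK eqxx in r_neq.
Qed.

Lemma word_act_mx_nil : word_act_mx [::] = 1%:M.
Proof.
by apply/matrixP => p q; rewrite !mxE /= (inj_eq enum_val_inj) eq_sym.
Qed.

Lemma trace_word_act_mx t :
  \tr (word_act_mx t) = #|[set w | word_act t w == w]|%:R.
Proof.
rewrite /mxtrace -sum1_card natr_sum [RHS]big_mkcond /=.
rewrite [RHS](reindex _ (onW_bij _ (@enum_val_bij (word n)))) /=.
by apply: eq_bigr => p _; rewrite mxE inE; case: eqP.
Qed.

Lemma tsetlin_mxE : tsetlin_mx x = \sum_e weight e *: word_act_mx [:: e].
Proof.
apply/matrixP => p q; rewrite mxE summxE sig_big_dep /=.
rewrite big_mkcond; apply: eq_bigr => e _; rewrite !mxE /=.
by case: eqP => _; rewrite ?mulr1 ?mulr0.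
Qed.

Lemma tsetlin_mxX k : tsetlin_mx x ^+ k
  = \sum_(t <- words_of_copies k) (\prod_(e <- t) weight e) *: word_act_mx t.
Proof.
elim: k => [|k IHk].
  by rewrite expr0 big_seq1 big_nil scale1r word_act_mx_nil.
rewrite exprS IHk big_allpairs_dep -mulmxE tsetlin_mxE mulmx_suml big_enum /=.
apply: eq_bigr => e _; rewrite mulmx_sumr; apply: eq_bigr => t _.
by rewrite big_cons [in RHS]word_act_mx_cons -scalemxAl -scalemxAr scalerA.
Qed.

(** Expanding the power gives the words of [k] copies outside [A]; the inclusion on the right says
    that [t] avoids [A]. *)
Lemma sumX_words A k : (\sum_(e | e \notin A) weight e) ^+ k
  = \sum_(t <- words_of_copies k)
      (\prod_(e <- t) weight e) *+ (A \subset ~: [set e in t]).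
Proof.
elim: k => [|k IHk].
  rewrite expr0 big_seq1 big_nil (_ : A \subset _) //.
  by apply/subsetP => e; rewrite !inE.
rewrite exprS IHk big_allpairs_dep big_enum /= mulr_suml [RHS](bigID [in A]) /= addrC.
rewrite [X in _ + X]big1 ?addr0 => [|e eA]; last first.
  rewrite big1 // => t _; case: (boolP (A \subset _)) => // /subsetP/(_ e eA).
  by rewrite !inE eqxx.
apply: eq_bigr => e eA; rewrite mulr_sumr; apply: eq_bigr => t _.
rewrite big_cons mulrnAr; congr (_ *+ nat_of_bool _).
apply/subsetP/subsetP => At a aA; have := At a aA;
  rewrite !inE ?negb_or; last by case/andP.
by move=> ->; rewrite andbT; apply: contraNneq eA => <-.
Qed.

(** [A] consists of the copies outside the chosen subsets of the theorem. *)
Definition eigenvalues : seq R :=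
  flatten [seq nseq (num_derangements (cont A)) (\sum_(e | e \notin A) weight e)
          | A : {set copy}].

Lemma trace_tsetlin_mxX k :
  \tr (tsetlin_mx x ^+ k) = \sum_(a <- eigenvalues) a ^+ k.
Proof.
rewrite big_flatten big_map big_enum /=.
(* For fixed [t], the sum over [A] counts the words on the copies outside [t], that is, the fixed
   words of [t]. *)
transitivity (\sum_(A : {set copy}) \sum_(t <- words_of_copies k)
    (\prod_(e <- t) weight e) *+ (A \subset ~: [set e in t])
      *+ num_derangements (cont A)).
  rewrite exchange_big /= tsetlin_mxX linear_sum; apply: eq_bigr => t _.
  rewrite linearZ /= trace_word_act_mx card_fixed_words card_word_derangements.
  rewrite natr_sum mulr_sumr big_mkcond; apply: eq_bigr => A _.
  by case: ifP => _; rewrite ?mulr0n ?mul0rn // mulr_natr.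
by apply: eq_bigr => A _; rewrite big_nseq -Monoid.iteropE sumrMnl -sumX_words.
Qed.

End Trace.

(** * Translation to families of subsets and to their sizes *)

Lemma char_poly_tsetlin (R : numDomainType) (m : nat) (n : 'I_m -> nat)
    (x : forall b : 'I_m, 'I_(n b) -> R) :
  char_poly (tsetlin_mx x)
    = \prod_(I : {dffun forall j : 'I_m, {set 'I_(n j)}})
        ('X - (\sum_(j < m) \sum_(s in I j) x j s)%:P)
          ^+ num_derangements (fun j => (n j - #|I j|)%N).
Proof.
rewrite (char_poly_of_traces (trace_tsetlin_mxX x)) big_flatten big_map big_enum /=.
(* Passing to the complement turns the sum over [e \notin A] into the sum over the [I j], and
   [cont A j] into [n j - #|I j|]. *)
pose F (I : {dffun forall j : 'I_m, {set 'I_(n j)}}) : {set {b : 'I_m & 'I_(n b)}} :=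
  [set e | tagged e \notin I (tag e)].
pose G (A : {set {b : 'I_m & 'I_(n b)}}) : {dffun forall j : 'I_m, {set 'I_(n j)}} :=
  [ffun j => [set s | Tagged (fun b => 'I_(n b)) s \notin A]].
have FG : cancel G F.
  by move=> A; apply/setP => -[b j]; rewrite !inE ffunE inE negbK.
have GF : cancel F G.
  by move=> I; apply/ffunP => b; rewrite ffunE; apply/setP => j; rewrite !inE negbK.
rewrite (reindex F) /=; last by exists G => ? _.
apply: eq_bigr => I _; rewrite big_nseq -Monoid.iteropE.
congr (('X - _%:P) ^+ _).
  by rewrite sig_big_dep /=; apply: eq_bigl => e; rewrite inE negbK.
apply: eq_num_derangements => j; rewrite /cont.
transitivity #|~: I j|; last by rewrite cardsCs setCK card_ord.
rewrite -sum1_card [RHS]big_mkcond /=.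
by apply: eq_bigr => s _; rewrite !inE; case: ifP.
Qed.

Theorem theorem6p2 (R : realFieldType) (m : nat) (n : 'I_m -> nat)
    (x : forall b : 'I_m, 'I_(n b) -> R)
    (x_ge0 : forall (b : 'I_m) (j : 'I_(n b)), 0 <= x b j)
    (x_sum1 : \sum_(b < m) \sum_(j < n b) x b j = 1) :
  char_poly (tsetlin_mx x)
    = \prod_(I : {dffun forall j : 'I_m, {set 'I_(n j)}})
        ('X - (\sum_(j < m) \sum_(s in I j) x j s)%:P)
          ^+ num_derangements (fun j => (n j - #|I j|)%N)
  /\
  forall xb : 'I_m -> R,
    (forall (b : 'I_m) (j : 'I_(n b)), x b j = xb b) ->
    char_poly (tsetlin_mx x)
      = \prod_(k : {dffun forall i : 'I_m, 'I_(n i).+1})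
          ('X - (\sum_(i < m) xb i *+ k i)%:P)
            ^+ (num_derangements (fun i => (n i - k i)%N)
                * \prod_(i < m) 'C(n i, k i))%N.
Proof.
split=> [|xb x_xb]; first exact: char_poly_tsetlin.
rewrite char_poly_tsetlin.
(* [inord] never falls back on its default here, as [#|I i|] is at most [n i]. *)
pose sizes (I : {dffun forall j : 'I_m, {set 'I_(n j)}}) :
    {dffun forall i : 'I_m, 'I_(n i).+1} := [ffun i => inord #|I i|].
have sizesE I i : sizes I i = #|I i| :> nat.
  by rewrite ffunE inordK // ltnS -[leqRHS](card_ord (n i)) max_card.
rewrite (partition_big sizes xpredT) //=; apply: eq_bigr => k _.
(* The fibre of [sizes] over [k] picks a subset of size [k i] for each [i]. All its factors
   coincide, so its cardinality multiplies the exponent. *)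
pose F i : pred {set 'I_(n i)} := fun B => #|B| == k i.
have card_F : #|(family F : simpl_pred {dffun forall j : 'I_m, {set 'I_(n j)}})|
    = (\prod_(i < m) 'C(n i, k i))%N.
  rewrite card_family foldrE big_map big_enum /=; apply: eq_bigr => i _.
  by have := card_draws 'I_(n i) (k i); rewrite card_ord cardsE.
rewrite exprM -card_F -prodr_const; apply: eq_big => [I|I /eqP Ik].
  apply/eqP/familyP => [Ik i|IF]; first by rewrite unfold_in /F -Ik sizesE.
  by apply/ffunP => i; apply/val_inj; rewrite [LHS]sizesE; apply/eqP/(IF i).
congr (('X - _%:P) ^+ _).
  apply: eq_bigr => i _; rewrite -Ik sizesE -sumr_const.
  by apply: eq_bigr => s _; rewrite x_xb.
by apply: eq_num_derangements => i; rewrite -Ik sizesE.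
Qed.
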